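(* Let $F\in\mathbb{Z}_{\ge0}$, $n\ge 2$, $1\le k\le n-1$, let $\mathcal{G}=C_n\{\pm1,\pm2,\dots,\pm k\}=(\mathcal{V},\mathcal{E})$ be the undirected circulant graph on $n$ agents, and let $\mathcal{L}\subset\mathcal{V}$ be a set of leaders. (1) If $\mathcal{G}$ contains a set $P_L\subseteq\mathcal{V}$ of consecutive agents such that $|P_L|\le k$ and $|P_L\cap\mathcal{L}|\ge 2F+1$, then $\mathcal{G}$ is strongly $(2F+1)$-robust with respect to $\mathcal{L}$. (2) If $\mathcal{G}$ contains a set $P_L\subseteq\mathcal{V}$ of consecutive agents such that $|P_L|\le k-F$ and $|P_L\cap\mathcal{L}|\ge F+1$, then $\mathcal{G}$ is trusted leader-follower (TLF) robust with parameter $F$ (with respect to the set $S=\mathcal{L}$).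
   Context: The undirected circulant graph $C_n\{\pm1,\dots,\pm k\}$ has vertex set $\mathcal{V}=\{1,\dots,n\}$ (indices taken modulo $n$) and edges $(i,(i\pm a)\bmod n)$ for all $i\in\mathcal{V}$ and $a\in\{1,\dots,k\}$. It is treated as a digraph with $(i,j)\in\mathcal{E}\iff(j,i)\in\mathcal{E}$, and $\mathcal{V}_i=\{j:(j,i)\in\mathcal{E}\}$ is the set of neighbors of $i$. A set of consecutive agents is a set of the form $\{a+1,a+2,\dots,a+m\}$ with indices taken modulo $n$ (e.g. $\{14,15,1,2\}$ for $n=15$). A nonempty set $C\subseteq\mathcal{V}$ is $r$-reachable if there is $i\in C$ with $|\mathcal{V}_i\setminus C|\ge r$. A graph is strongly $r$-robust with respect to $S\subset\mathcal{V}$ if every nonempty $C\subseteq\mathcal{V}\setminus S$ is $r$-reachable. A graph is TLF robust with parameter $F$ (with respect to $S\subset\mathcal{V}$) if for every nonempty $C\subseteq\mathcal{V}\setminus S$ at least one of the following holds: (i) there exists $i\in C$ with $|\mathcal{V}_i\cap S|\ge F+1$; (ii) $C$ is $(2F+1)$-reachable. *)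

(* Defs.v *)
From mathcomp Require Import all_boot.
Set Implicit Arguments.
Unset Strict Implicit.
Unset Printing Implicit Defensive.

Section Digraph.

Variables (V : finType) (e : rel V).

(* [e j i] is the edge (j, i), from j to i: these are in-neighbours. *)
Definition neighbors (i : V) : {set V} := [set j | e j i].

Definition reachable (r : nat) (C : {set V}) : Prop :=
  C != set0 /\ exists2 i, i \in C & r <= #|neighbors i :\: C|.

Definition strongly_robust (r : nat) (S : {set V}) : Prop :=
  forall C : {set V}, C != set0 -> C \subset ~: S -> reachable r C.

Definition TLF_robust (F : nat) (S : {set V}) : Prop :=
  forall C : {set V}, C != set0 -> C \subset ~: S ->
    (exists2 i, i \in C & F + 1 <= #|neighbors i :&: S|)
    \/ reachable (2 * F + 1) C.

End Digraph.

(* The agents 1, ..., n are represented by their residues modulo n, agent n  *)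
(* being 0 : 'I_n. The congruence j = i - a is written i = j + a, since      *)
(* subtraction on nat is truncated.                                          *)
Definition circulant (n k : nat) : rel 'I_n :=
  fun i j => [exists a : 'I_k.+1,
    (1 <= a) && ((j == i + a %[mod n]) || (i == j + a %[mod n]))].

Definition consecutive (n : nat) (P : {set 'I_n}) : Prop :=
  exists a m : nat, P = [set i : 'I_n | [exists t : 'I_m.+1,
    (1 <= t) && (i == a + t %[mod n])]].

(* Main.v *)
Require Import Defs.
From mathcomp Require Import all_boot.

(** Walk clockwise from the start of the block [P = {a+1, ..., a+m}], [m <= k],
    and let [i = a + s], [s >= 1], be the first agent met that lies in [C].
    If [s <= k + 1], every other agent of [P] is within distance [k] of [i], so
    [i] hears all the leaders of [P], and none of them is in [C].  Otherwise the
    [k] agents immediately before [i] are all neighbours of [i] outside [C]. *)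

Lemma eqn_small_mod {n t u : nat} :
  t < n -> u < n -> (t == u %[mod n]) = (t == u).
Proof. by move=> tn un; rewrite !modn_small. Qed.

(** At most [n] consecutive integers have distinct residues modulo [n], so the arc starting at [b]
    injects into [D]. *)
Lemma arc_card {n : nat} (b : nat) {c : nat} {D : {set 'I_n}} :
  c <= n ->
  (forall t, t < c -> forall i : 'I_n, i == b + t %[mod n] -> i \in D) ->
  c <= #|D|.
Proof.
case: c => [//|c] c_le sub_D.
have n_gt0 : 0 < n by apply: leq_trans c_le.
pose f (t : 'I_c.+1) : 'I_n := Ordinal (ltn_pmod (b + t) n_gt0).
have f_inj : injective f.
  move=> t u /(congr1 val) /= /eqP; rewrite eqn_modDl.
  by rewrite eqn_small_mod ?(leq_trans (ltn_ord _) c_le) // => /eqP /val_inj.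
rewrite -[c.+1]card_ord -(card_imset _ f_inj); apply/subset_leq_card/subsetP.
by move=> _ /imsetP[t _ ->]; apply: (sub_D t) => //=; rewrite modn_mod.
Qed.

(** An arc of length [m >= n] wraps around and fills all [n > k] agents, so the bound on [#|P|]
    passes to [m]. *)
Lemma consecutiveP {n k : nat} {P : {set 'I_n}} :
  consecutive P -> #|P| <= k -> k < n ->
  exists a m, m <= k /\
    forall i, i \in P -> exists2 t, 1 <= t <= m & i == a + t %[mod n].
Proof.
case=> a [m defP] P_le k_lt; exists a, m; split; last first.
  move=> i; rewrite defP inE => /existsP[t /andP[t_gt0 it]].
  by exists t => //; rewrite t_gt0 -ltnS ltn_ord.
have : minn m n <= #|P|.
  apply: (arc_card a.+1) => [|t]; first exact: geq_minr.
  rewrite leq_min => /andP[t_lt _] i it; rewrite defP inE.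
  have t1_lt : t.+1 < m.+1 by [].
  apply/existsP; exists (Ordinal t1_lt).
  by rewrite /= addnS -addSn it.
move=> /leq_trans/(_ P_le); rewrite geq_min => /orP[//|].
by rewrite leqNgt k_lt.
Qed.

Lemma circulant_neighbor {n k b t s : nat} {i j : 'I_n} :
  i == b + s %[mod n] -> j == b + t %[mod n] ->
  t != s -> t <= s + k -> s <= t + k -> j \in neighbors (@circulant n k) i.
Proof.
move=> /eqP is_ /eqP jt neq_ts t_le s_le; rewrite inE; apply/existsP.
(* One truncated difference is 0, so the maximum is the distance between [s] and [t], the witness
   for [circulant]. *)
have dist_le : maxn (t - s) (s - t) < k.+1
    by rewrite ltnS geq_max !leq_subLR t_le.
exists (Ordinal dist_le) => /=; move: neq_ts; rewrite neq_ltn.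
case/orP=> lt_ts; rewrite leq_max !subn_gt0 lt_ts ?orbT /=.
- rewrite (eqP (ltnW lt_ts : _ - _ == 0)) max0n; apply/orP; left.
  by rewrite -modnDml jt modnDml -addnA subnKC 1?ltnW // is_.
- rewrite (eqP (ltnW lt_ts : _ - _ == 0)) maxn0; apply/orP; right.
  by rewrite -modnDml is_ modnDml -addnA subnKC 1?ltnW // jt.
Qed.

Lemma first_agent {n k : nat} {P C : {set 'I_n}} :
  k < n -> consecutive P -> #|P| <= k -> C != set0 ->
  exists2 i, i \in C &
    P :\ i \subset neighbors (@circulant n k) i
    \/ k <= #|neighbors (@circulant n k) i :\: C|.
Proof.
move=> k_lt P_cons P_le /set0Pn[c cC].
have n_gt0 : 0 < n by apply: leq_trans k_lt.
have [a [m [m_le P_sub]]] := consecutiveP P_cons P_le k_lt.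
pose meets s := (0 < s) && [exists i in C, i == a + s %[mod n]].
have ex_s : exists s, meets s.
  (* Adding a multiple of [n] larger than [a] keeps the offset from [a] to [c] positive. *)
  exists (c + (a.+1 * n - a)).
  have lt_a : a < a.+1 * n by exact: leq_pmulr.
  rewrite /meets addn_gt0 subn_gt0 lt_a orbT; apply/existsP; exists c.
  by rewrite cC addnCA subnKC 1?ltnW // addnC modnMDl eqxx.
case: (ex_minnP ex_s) => s /andP[s_gt0 /existsP[i /andP[iC is_]]] s_min.
(* Offsets in [P] run from 1 to [m <= k], so [k.+1] is the last value of [s] within distance [k] of
   offset 1. *)
exists i => //; have [s_le|s_gt] := leqP s k.+1; [left | right].
- apply/subsetP=> j; rewrite !inE => /andP[ji /P_sub[t /andP[t_gt0 t_le] jt]].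
  have := circulant_neighbor (k := k) is_ jt; rewrite inE; apply.
  + apply: contraNneq ji => ts; apply/eqP/val_inj/eqP.
    by rewrite -(eqn_small_mod (ltn_ord j) (ltn_ord i)) (eqP is_) -ts.
  + by rewrite (leq_trans t_le) // (leq_trans m_le) // leq_addl.
  + by rewrite (leq_trans s_le) // -add1n leq_add2r.
- have sk_le : k <= s by apply: leq_trans (ltnW s_gt).
  apply: (arc_card (a + (s - k))) => [|t t_lt j]; first exact: ltnW.
  rewrite -addnA => jt.
  have st_lt : s - k + t < s by rewrite -[ltnRHS](subnK sk_le) ltn_add2l.
  rewrite inE; apply/andP; split.
  (* The offset [s - k + t] is positive, so [j] in [C] would contradict the minimality of [s]. *)
  + apply: contraL st_lt => jC; rewrite -leqNgt; apply: s_min.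
    rewrite /meets addn_gt0 subn_gt0 (ltnW s_gt) /=.
    by apply/existsP; exists j; rewrite jC.
  + apply: circulant_neighbor is_ jt _ _ _.
    * by rewrite neq_ltn st_lt.
    * by rewrite (leq_trans (ltnW st_lt)) ?leq_addr.
    * by rewrite addnAC subnK ?leq_addr.
Qed.

Theorem theorem4 (F n k : nat) (n_ge2 : 2 <= n) (k_ge1 : 1 <= k)
    (k_le : k <= n - 1) (L : {set 'I_n}) :
  ((exists P : {set 'I_n},
      [/\ consecutive P, #|P| <= k & 2 * F + 1 <= #|P :&: L|]) ->
    strongly_robust (@circulant n k) (2 * F + 1) L)
  /\
  ((exists P : {set 'I_n},
      [/\ consecutive P, #|P| + F <= k & F + 1 <= #|P :&: L|]) ->
    TLF_robust (@circulant n k) F L).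
Proof.
have k_lt : k < n by rewrite -(subnK (ltnW n_ge2)) addn1 ltnS.
(* Removing [i] from [P] loses no leader, since [i] lies in [C], which avoids [L]. *)
have leaders_heard (P C : {set 'I_n}) i :
    C \subset ~: L -> i \in C -> P :\ i \subset neighbors (@circulant n k) i ->
    P :&: L \subset neighbors (@circulant n k) i :&: L.
  move=> CL iC P_sub; apply/subsetP=> j; rewrite !in_setI => /andP[jP jL].
  rewrite jL andbT (subsetP P_sub) // in_setD1 jP andbT.
  by apply: contraTneq jL => ->; rewrite -in_setC (subsetP CL).
split=> -[P [P_cons P_le PL_ge]] C C_neq0 CL.
- have [i iC nbr_i] := first_agent k_lt P_cons P_le C_neq0.
  split=> //; exists i => //; case: nbr_i => [P_sub|k_out].
  + apply: leq_trans PL_ge _; apply: subset_leq_card.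
    apply: subset_trans (leaders_heard _ _ _ CL iC P_sub) _.
    by rewrite setDE setIS // -setCS setCK.
  (* The leaders themselves force [k >= #|P| >= 2 * F + 1]. *)
  + apply: leq_trans k_out; apply: leq_trans P_le; apply: leq_trans PL_ge _.
    exact/subset_leq_card/subsetIl.
- have P_le' : #|P| <= k by apply: leq_trans P_le; apply: leq_addr.
  have [i iC [P_sub|k_out]] := first_agent k_lt P_cons P_le' C_neq0.
  + left; exists i => //; apply: leq_trans PL_ge _; apply: subset_leq_card.
    exact: leaders_heard CL iC P_sub.
  + right; split=> //; exists i => //; apply: leq_trans k_out.
    (* Here [2 * F + 1 = (F + 1) + F <= #|P| + F <= k]: the slack [F] in the length of [P] makes up
       for having only [F + 1] leaders. *)
    apply: leq_trans P_le; rewrite mul2n -addnn addnAC leq_add2r.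
    apply: leq_trans PL_ge _; exact/subset_leq_card/subsetIl.
Qed.
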